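(* Let $(A,[-,-])$ be a Malcev algebra, $\alpha:A\to A$ an algebra morphism, $(V,\rho)$ a representation of $A$, and $\beta:V\to V$ a linear map such that $\beta\rho(x)(a)=\rho(\alpha(x))\beta(a)$ for all $x\in A$, $a\in V$. Define $\widetilde\rho(x)(a)=\rho(\alpha(x))\beta(a)$ for all $x\in A$, $a\in V$. Then $(V,\widetilde\rho,\beta)$ is a representation of the Hom-Malcev algebra $(A,[-,-]_\alpha,\alpha)$, where $[x,y]_\alpha=\alpha([x,y])$.
   Context: All vector spaces are over a field $\mathbb K$ of characteristic $0$. A Hom-Malcev algebra is a triple $(A,[-,-],\alpha)$ with $[-,-]$ bilinear anti-symmetric, $\alpha:A\to A$ linear with $\alpha([x,y])=[\alpha(x),\alpha(y)]$, and $J_\alpha(\alpha(x),\alpha(y),[x,z])=[J_\alpha(x,y,z),\alpha^2(x)]$ for all $x,y,z$, where $J_\alpha(x,y,z)=[[x,y],\alpha(z)]+[[y,z],\alpha(x)]+[[z,x],\alpha(y)]$. A Malcev algebra is the case $\alpha=\mathrm{Id}$. If $(A,[-,-])$ is a Malcev algebra and $\alpha$ an endomorphism of it, $(A,\alpha\circ[-,-],\alpha)$ is a Hom-Malcev algebra (known result of Yau). A representation of a Hom-Malcev algebra $(A,[-,-],\alpha)$ is a triple $(V,\rho,\beta)$ with $V$ a vector space, $\rho:A\to \mathrm{End}(V)$ linear, $\beta\in \mathrm{End}(V)$, such that for all $x,y,z\in A$: $\rho(\alpha(x))\beta=\beta\rho(x)$ and $$\rho([[x,y],\alpha(z)])\beta^2=\rho(\alpha^2(x))\rho(\alpha(y))\rho(z)-\rho(\alpha^2(z))\rho(\alpha(x))\rho(y)+\rho(\alpha^2(y))\rho([z,x])\beta-\rho(\alpha([y,z]))\rho(\alpha(x))\beta.$$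 A representation $(V,\rho)$ of a Malcev algebra is the case $\alpha=\mathrm{Id}_A$, $\beta=\mathrm{Id}_V$. *)

(* Defs.v *)
From HB Require Import structures.
From mathcomp Require Import all_boot all_order all_algebra.

Set Implicit Arguments.
Unset Strict Implicit.
Unset Printing Implicit Defensive.

Import GRing.Theory.
Local Open Scope ring_scope.

Section HomMalcev.
Variables (K : fieldType) (A : lmodType K).
Implicit Types (br : A -> A -> A) (alpha : {linear A -> A}).

Definition hom_jacobian br alpha (x y z : A) : A :=
  br (br x y) (alpha z) + br (br y z) (alpha x) + br (br z x) (alpha y).

Record is_hom_malcev br alpha : Prop := IsHomMalcev {
  hom_malcev_bilinear : bilinear_for *:%R *:%R br;
  hom_malcev_antisym : forall x y, br x y = - br y x;
  hom_malcev_mult : forall x y, alpha (br x y) = br (alpha x) (alpha y);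
  hom_malcev_identity : forall x y z,
    hom_jacobian br alpha (alpha x) (alpha y) (br x z)
      = br (hom_jacobian br alpha x y z) (alpha (alpha x))
}.

Definition is_malcev br : Prop := is_hom_malcev br idfun.

Variable V : lmodType K.
Implicit Types (rho : A -> V -> V) (beta : {linear V -> V}).

(* A linear map A -> End(V) is encoded in curried form, as a bilinear map
   A -> V -> V; identities in End(V) are stated pointwise. *)
Record is_hom_malcev_rep br alpha rho beta : Prop := IsHomMalcevRep {
  hom_malcev_rep_bilinear : bilinear_for *:%R *:%R rho;
  hom_malcev_rep_twist : forall x v,
    rho (alpha x) (beta v) = beta (rho x v);
  hom_malcev_rep_identity : forall x y z v,
    rho (br (br x y) (alpha z)) (beta (beta v))
      = rho (alpha (alpha x)) (rho (alpha y) (rho z v))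
        - rho (alpha (alpha z)) (rho (alpha x) (rho y v))
        + rho (alpha (alpha y)) (rho (br z x) (beta v))
        - rho (alpha (br y z)) (rho (alpha x) (beta v))
}.

Definition is_malcev_rep br rho : Prop :=
  is_hom_malcev_rep br idfun rho idfun.

End HomMalcev.

(* Main.v *)
Require Import Defs.
From HB Require Import structures.
From mathcomp Require Import all_boot all_order all_algebra.

Set Implicit Arguments.
Unset Strict Implicit.
Unset Printing Implicit Defensive.

Import GRing.Theory.
Local Open Scope ring_scope.

(** Yau twisting: since [alpha] is multiplicative and [beta] intertwines [rho x] with
    [rho (alpha x)], all twists can be pulled to the outside. Each twisted identity is then a fixed
    power of [alpha] or [beta] applied to the untwisted one, and linearity concludes. *)

Theorem proposition5p1 (K : fieldType) (charK : [pchar K] =i pred0)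
    (A V : lmodType K)
    (br : A -> A -> A) (malcevA : is_malcev br)
    (alpha : {linear A -> A})
    (alphaM : forall x y : A, alpha (br x y) = br (alpha x) (alpha y))
    (rho : A -> V -> V) (repV : is_malcev_rep br rho)
    (beta : {linear V -> V})
    (betaP : forall (x : A) (a : V), beta (rho x a) = rho (alpha x) (beta a)) :
  let br_alpha := fun x y : A => alpha (br x y) in
  let rho_tilde := fun (x : A) (a : V) => rho (alpha x) (beta a) in
  is_hom_malcev br_alpha alpha
  /\ is_hom_malcev_rep br_alpha alpha rho_tilde beta.
Proof.
move=> br_alpha rho_tilde.
case: malcevA => [[brl brr] antis _ malcev]; case: repV => [[rhol rhor] _ repI].
(* Each double bracket carries two twists, one per bracket; the inner one and the [alpha] on the
   third argument leave together by [alphaM]. *)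
have jacM x y z : hom_jacobian br_alpha alpha x y z
    = alpha (alpha (hom_jacobian br idfun x y z)).
  by rewrite /hom_jacobian /br_alpha -!alphaM -!linearD.
split; split.
- by split=> [x|x] a u v; rewrite /br_alpha -linearP -?brl -?brr.
- by move=> x y; rewrite /br_alpha antis linearN.
- by move=> x y; rewrite /br_alpha alphaM.
(* Both sides are the cube of [alpha] applied to the two sides of the Malcev identity. *)
- move=> x y z; rewrite !jacM /br_alpha -!alphaM -malcev.
  by rewrite /hom_jacobian /= -!alphaM -!linearD.
- split=> [v|x] a u w; rewrite /rho_tilde linearP; [exact: rhol|exact: rhor].
- by move=> x v; rewrite /rho_tilde betaP.
(* Every term has arguments of [rho] twisted just enough for three copies of [beta] to move out in
   front, so the goal is the cube of [beta] applied to [repI]. *)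
- move=> x y z v; rewrite /rho_tilde /br_alpha -!alphaM -!betaP.
  by rewrite (repI x y z v) /= !(linearB, linearD).
Qed.
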